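(* Let $\mathbf{F}$ be a field of characteristic $2$ and $m\ge1$. For each unordered pair $\{A,B\}$ of (not necessarily distinct) elements of $\{0,1\}^m$ with $|A|,|B|\ge2$, choose one of the two orderings $(A,B)$ or $(B,A)$ and take the corresponding type II relation. Then $\ker(\pi)$ is minimally generated, as an ideal of $Q$, by (i) the $2^m-\binom{m}{2}-m-1$ type I relations $\rho_A$ for $A\in\{0,1\}^m$ with $|A|\ge3$, together with (ii) the $\binom{2^m-m}{2}$ chosen type II relations, one for each unordered product of two (possibly equal) of the $2^m-m-1$ elements $\mathrm{Tr}(A)$, $|A|\ge2$.
   Context: Let $S=\mathbf{F}[x_1,y_1,\dots,x_m,y_m]$ with the $\mathbf{F}$-algebra automorphism $\sigma(x_i)=x_i$, $\sigma(y_i)=y_i+x_i$ of order 2, and let $S^{C_2}$ be the ring of $\sigma$-invariants. For $A=(a_1,\dots,a_m)\in\mathbb{N}^m$ write $x^A=\prod_s x_s^{a_s}$, $y^A=\prod_s y_s^{a_s}$, $N^A=\prod_s N_s^{a_s}$, $|A|=\sum_s a_s$. $A\le B$ means componentwise $\le$; $L<A$ means $L\le A$, $L\ne A$; sums/differences are componentwise. Elements of $\{0,1\}^m$ are identified with subsets of $\{1,\dots,m\}$; $\cap,\setminus$ are set operations. $\Delta_s$ has $1$ in position $s$ and $0$ elsewhere. For $A\in\{0,1\}^m$, $\mathrm{tr}(A)=y^A+\prod_s(y_s+x_s)^{a_s}$. Let $R=\mathbf{F}[x_1,\dots,x_m,N_1,\dots,N_m]$ (polynomial ring in $2m$ indeterminates),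 $Q=R[\mathrm{Tr}(A):A\in\{0,1\}^m,|A|\ge2]$ (polynomial ring), and $\pi:Q\to S^{C_2}$ the $\mathbf{F}$-algebra homomorphism with $\pi(x_i)=x_i$, $\pi(N_i)=y_i^2+x_iy_i$, $\pi(\mathrm{Tr}(A))=\mathrm{tr}(A)$ (it is known to be surjective). Convention: $\mathrm{Tr}(0)=0$ and $\mathrm{Tr}(\Delta_s)=x_s$ in $Q$. The type I relation for $A\in\{0,1\}^m$ with $|A|\ge3$ is $\rho_A=\sum_{0<L<A}x^{A-L}\mathrm{Tr}(L)\in Q$. For an ordered pair $(A,B)$ with $|A|,|B|\ge2$, with $I=A\cap B$, $J=A\setminus B$, $K=B\setminus A$, the type II relation is $\mathrm{Tr}(A)\mathrm{Tr}(B)+\sum_{L<I}x^{I-L}N^L\mathrm{Tr}(I-L+J+K)+N^I\sum_{L<J}x^{J-L}\mathrm{Tr}(L+K)\in Q$. Both types lie in $\ker(\pi)$. $Q$ is graded by $\deg x_i=1$, $\deg N_i=2$, $\deg\mathrm{Tr}(A)=|A|$; $\ker\pi$ is homogeneous, and a generating set is minimal if no proper subset generates. *)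

(* Defs.v *)
From HB Require Import structures.
From mathcomp Require Import all_boot all_order all_algebra.
From mathcomp Require Import mpoly.
Set Implicit Arguments. Unset Strict Implicit. Unset Printing Implicit Defensive.
Import Order.TTheory GRing.Theory.
Local Open Scope ring_scope.

(* Subsets of {1..m} (= elements of {0,1}^m) are {set 'I_m}. *)
Definition TrIdx (m : nat) := {A : {set 'I_m} | (2 <= #|A|)%N}.

(* Variables of Q: x_1..x_m, N_1..N_m, Tr(A) (|A| >= 2). *)
Definition QVar (m : nat) := ('I_m + 'I_m + TrIdx m)%type.

Definition Qring (F : fieldType) (m : nat) := {mpoly F[#|{: QVar m}|]}.
(* S = F[x_1,y_1,...,x_m,y_m]; x_i is variable lshift, y_i is rshift. *)
Definition Sring (F : fieldType) (m : nat) := {mpoly F[m + m]}.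

Section Defs.
Variables (F : fieldType) (m : nat).

Definition Qvar (v : QVar m) : Qring F m := 'X_(enum_rank v).
Definition Qx (s : 'I_m) : Qring F m := Qvar (inl (inl s)).
Definition QN (s : 'I_m) : Qring F m := Qvar (inl (inr s)).

(* Tr(L) in Q, with the conventions Tr(0) = 0 and Tr(Delta_s) = x_s. *)
Definition Tr (L : {set 'I_m}) : Qring F m :=
  match insub L : option (TrIdx m) with
  | Some A => Qvar (inr A)
  | None => if [pick s in L] is Some s then (if #|L| == 1%N then Qx s else 0) else 0
  end.

Definition xpow (A : {set 'I_m}) : Qring F m := \prod_(s in A) Qx s.
Definition Npow (A : {set 'I_m}) : Qring F m := \prod_(s in A) QN s.

Definition rho (A : {set 'I_m}) : Qring F m :=
  \sum_(L : {set 'I_m} | (set0 \proper L) && (L \proper A)) xpow (A :\: L) * Tr L.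

Definition typeII (A B : {set 'I_m}) : Qring F m :=
  let I := A :&: B in let J := A :\: B in let K := B :\: A in
  Tr A * Tr B
  + \sum_(L : {set 'I_m} | L \proper I) xpow (I :\: L) * Npow L * Tr ((I :\: L) :|: J :|: K)
  + Npow I * \sum_(L : {set 'I_m} | L \proper J) xpow (J :\: L) * Tr (L :|: K).

Definition Sx (s : 'I_m) : Sring F m := 'X_(lshift m s).
Definition Sy (s : 'I_m) : Sring F m := 'X_(rshift m s).

Definition trS (A : {set 'I_m}) : Sring F m :=
  \prod_(s in A) Sy s + \prod_(s in A) (Sy s + Sx s).

Definition pi_var (v : QVar m) : Sring F m :=
  match v with
  | inl (inl s) => Sx s
  | inl (inr s) => Sy s ^+ 2 + Sx s * Sy s
  | inr A => trS (val A)
  end.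

(* pi : Q -> S^{C_2} \subset S, the F-algebra homomorphism. *)
Definition pi (q : Qring F m) : Sring F m :=
  mmap (fun c : F => c%:MP) (fun i => pi_var (enum_val i)) q.

Definition in_ker_pi (q : Qring F m) : Prop := pi q = 0.
End Defs.

Definition in_ideal_gen (Rg : comNzRingType) (I : finType) (g : I -> Rg) (q : Rg) : Prop :=
  exists c : I -> Rg, q = \sum_(i : I) c i * g i.

Definition generates (Rg : comNzRingType) (I : finType) (g : I -> Rg) (K : Rg -> Prop) : Prop :=
  forall q, in_ideal_gen g q <-> K q.

Definition drop_gen (Rg : comNzRingType) (I : finType) (g : I -> Rg) (i : I) :
  {j : I | j != i} -> Rg := fun j => g (val j).

(* Minimal generating family: it generates K and no proper subfamily does
   (equivalently, no family obtained by deleting one member does). *)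
Definition minimally_generates (Rg : comNzRingType) (I : finType) (g : I -> Rg)
  (K : Rg -> Prop) : Prop :=
  generates g K /\ forall i : I, ~ generates (@drop_gen Rg I g i) K.

Definition ordering_choice (m : nat) (P : pred (TrIdx m * TrIdx m)) : Prop :=
  forall A B : TrIdx m, (P (A, B) || P (B, A)) /\ (P (A, B) && P (B, A) -> A = B).

Definition TypeIIdx (m : nat) (P : pred (TrIdx m * TrIdx m)) :=
  {p : TrIdx m * TrIdx m | P p}.
Definition TypeIdx (m : nat) := {A : {set 'I_m} | (3 <= #|A|)%N}.

Definition gens (F : fieldType) (m : nat) (P : pred (TrIdx m * TrIdx m)) :
  TypeIdx m + TypeIIdx P -> Qring F m :=
  fun i => match i with
           | inl A => rho F (val A)
           | inr p => typeII F (val (val p).1) (val (val p).2)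
           end.
Arguments gens F m P : clear implicits.

(* Main.v *)
Require Import Defs.
From HB Require Import structures.
From mathcomp Require Import all_boot all_order all_algebra.
From mathcomp Require Import mpoly ring zify.
Import Order.TTheory GRing.Theory.
Local Open Scope ring_scope.

(* S is free over R = F[x, N] with basis the y^A. Modulo the type II relations every
   element of Q is an R-linear combination c + sum_A d_A Tr(A), and it lies in ker pi
   iff (sigma - 1)(sum_A d_A y^A) = c. Then c lies in the ideal (x_1, ..., x_m), so after
   correcting the d_A with |A| = 1 the element sum_A d_A y^A is invariant. Splitting off
   one y_s at a time (x_1, ..., x_m is a regular sequence) shows that an invariant is,
   up to an element of R, a transfer (sigma - 1)(sum_A r_A y^A); comparing coefficients,
   the given element of Q is sum_A r_A rho_A. *)

(** The relation [rho A] is (sigma - 1)(y^A) with every y^L replaced by [Tr L], the term L = 0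
    vanishing because Tr(0) = 0. Hence a coefficient function that agrees with the transfer of r
    away from the empty set gives in Q the combination of the [rho A] with coefficients r. Likewise
    Tr({t}) = x_t mirrors (sigma - 1)(y_t) = x_t, so correcting the singleton coefficients cancels c
    in S and absorbs it in Q.

    Splitting an invariant as f0 + y_s h yields (sigma - 1)(h) = 0 and (sigma - 1)(f0) = x_s h. By
    induction h is a transfer up to its constant coefficient. That coefficient is the obstacle,
    since 1 is invariant without being a transfer. The second equation puts x_s times it in the
    ideal of the other x_t, regularity removes x_s, and a linear form in the other y_t then accounts
    for it. *)

(** * The operator sigma - 1 on R-combinations of the y^A, and its exactness *)

Section Transfer.
Variables (R : comNzRingType) (m : nat) (x : 'I_m -> R).
Hypothesis addxx : forall a : R, a + a = 0.
Implicit Types (f g : {set 'I_m} -> R) (A B E L : {set 'I_m}) (s t : 'I_m).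

Definition xmon A : R := \prod_(s in A) x s.

(* A function f encodes the element sum_A f A * y^A; [transfer f] encodes its image
   under sigma - 1, since (y + x)^A = sum_(L <= A) x^(A - L) y^L. *)
Definition transfer f L : R :=
  \sum_(A : {set 'I_m} | L \proper A) xmon (A :\: L) * f A.

Definition in_span E (r : R) := exists c : 'I_m -> R, r = \sum_(t in E) x t * c t.

Definition supp_in E f := forall A, ~~ (A \subset E) -> f A = 0.

(* The element f + y_s * g, when f and g do not involve y_s. *)
Definition glue s f g L := if s \in L then g (L :\ s) else f L.

Lemma xmonU1 s A : s \notin A -> xmon (s |: A) = x s * xmon A.
Proof. by move=> sA; rewrite /xmon big_setU1. Qed.

Lemma xmon1 s : xmon [set s] = x s.
Proof. by rewrite /xmon big_set1. Qed.

Lemma xmonD1 s A : s \in A -> xmon A = x s * xmon (A :\ s).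
Proof. by move=> sA; rewrite /xmon (big_setD1 s). Qed.

Lemma eq_transfer f g L :
  (forall A, L \proper A -> f A = g A) -> transfer f L = transfer g L.
Proof. by move=> fg; apply: eq_bigr => A /fg ->. Qed.

Lemma transferD f g L :
  transfer (fun A => f A + g A) L = transfer f L + transfer g L.
Proof. by rewrite /transfer -big_split; apply: eq_bigr => A _; rewrite mulrDr. Qed.

Lemma transferZ a f L : transfer (fun A => a * f A) L = a * transfer f L.
Proof. by rewrite /transfer big_distrr; apply: eq_bigr => A _; rewrite mulrCA. Qed.

Lemma transfer_supp E f L : supp_in E f -> ~~ (L \subset E) -> transfer f L = 0.
Proof.
move=> fE LE; apply: big1 => A /proper_sub LA; rewrite fE ?mulr0 //.
by apply: contra LE; apply: subset_trans.
Qed.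

Lemma sum_set_split s (F : {set 'I_m} -> R) :
  \sum_A F A = \sum_(A : {set 'I_m} | s \notin A) F A
             + \sum_(A : {set 'I_m} | s \notin A) F (s |: A).
Proof.
rewrite (bigID (fun A : {set 'I_m} => s \notin A)) /=; congr (_ + _).
rewrite (reindex_onto (fun A => s |: A) (fun A => A :\ s)) /=.
  apply: eq_bigl => A; rewrite setU11 /=.
  apply/eqP/idP => [<-|sA]; [by rewrite !inE eqxx | exact: setU1K].
by move=> A; rewrite negbK => sA; exact: setD1K.
Qed.

(** When f and g do not involve y_s, (sigma - 1)(f + y_s g) = (sigma - 1)(f) + x_s sigma(g) + y_s
    (sigma - 1)(g), and only the last summand involves y_s. *)
Lemma transfer_glue_in s f g L :
  s \in L -> supp_in (~: [set s]) g ->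
  transfer (glue s f g) L = transfer g (L :\ s).
Proof.
move=> sL gs; rewrite /transfer big_mkcond (sum_set_split s) /=.
rewrite big1 ?add0r; last first.
  by move=> A sA; case: ifP => // /proper_sub/subsetP/(_ _ sL) sA'; rewrite sA' in sA.
rewrite [RHS]big_mkcond (sum_set_split s) /=.
rewrite [X in _ = _ + X]big1 ?addr0; last first.
  move=> A sA; case: ifP => // _; rewrite gs ?mulr0 //.
  by apply/subsetPn; exists s; rewrite ?inE eqxx.
apply: eq_bigr => A sA; rewrite /glue setU11 setU1K //.
have -> : (L \proper s |: A) = (L :\ s \proper A).
  rewrite -{1}(setD1K sL) !properE; congr (_ && ~~ _).
    apply/idP/idP => [/(setSD [set s])|]; last exact: setUS.
    by rewrite !setU1K // !inE eqxx.
  apply/idP/idP => [/(setSD [set s])|]; last exact: setUS.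
  by rewrite !setU1K // !inE eqxx.
congr (if _ then xmon _ * _ else _).
by apply/setP => t; rewrite !inE; case: eqP => // ->; rewrite sL (negbTE sA).
Qed.

(** This is the part free of y_s in the same formula: [g L + transfer g L] is the coefficient of y^L
    in sigma(g). *)
Lemma transfer_glue_out s f g L :
  s \notin L -> supp_in (~: [set s]) f -> supp_in (~: [set s]) g ->
  transfer (glue s f g) L = transfer f L + x s * (g L + transfer g L).
Proof.
move=> sL fs gs; rewrite {1 2}/transfer big_mkcond (sum_set_split s) /=.
rewrite [X in _ = X + _]big_mkcond (sum_set_split s) /=.
rewrite [X in _ = _ + X + _]big1 ?addr0; last first.
  move=> A sA; case: ifP => // _; rewrite fs ?mulr0 //.
  by apply/subsetPn; exists s; rewrite ?inE eqxx.
congr (_ + _); first by apply: eq_bigr => A sA; rewrite /glue (negbTE sA).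
have -> : g L + transfer g L = \sum_(A : {set 'I_m} | L \subset A) xmon (A :\: L) * g A.
  rewrite (bigD1 L) //= setDv /xmon big_set0 mul1r; congr (_ + _).
  by apply: eq_bigl => A; rewrite properEneq andbC eq_sym.
rewrite [in RHS]big_mkcond (sum_set_split s) /=.
rewrite [X in _ = _ * (_ + X)]big1 ?addr0; last first.
  move=> A sA; case: ifP => // _; rewrite gs ?mulr0 //.
  by apply/subsetPn; exists s; rewrite ?inE eqxx.
rewrite big_distrr /=; apply: eq_bigr => A sA; rewrite /glue setU11 setU1K //.
have -> : (L \proper s |: A) = (L \subset A).
  rewrite properE; apply/andP/idP => [[LA _]|LA]; last first.
    split; first by apply: subset_trans LA (subsetUr _ _).
    by apply/subsetPn; exists s; rewrite ?setU11.
  apply/subsetP => t tL; have := subsetP LA t tL; rewrite !inE.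
  by case: eqP tL sL => // -> ->.
case: ifP => LA; last by rewrite mulr0.
rewrite mulrA -xmonU1; last by rewrite !inE (negbTE sA) andbF.
congr (xmon _ * _); apply/setP => t; rewrite !inE.
by case: eqP => // ->; rewrite (negbTE sL).
Qed.

Lemma glueK s f : exists g h,
  [/\ f =1 glue s g h, supp_in (~: [set s]) g, supp_in (~: [set s]) h
    & forall E, supp_in (s |: E) f -> supp_in E g /\ supp_in E h].
Proof.
exists (fun L => if s \in L then 0 else f L), (fun L => if s \in L then 0 else f (s |: L)).
have supps L : ~~ (L \subset ~: [set s]) -> s \in L.
  by rewrite subsetC sub1set !inE negbK.
split=> [L|L /supps -> //|L /supps -> //|E fE].
  by rewrite /glue !inE eqxx /=; case: (boolP (s \in L)) => // sL; rewrite setD1K.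
split=> L LE; case: ifP => // sL; apply: fE; apply: contra LE => /subsetP LE.
  apply/subsetP => t tL; have := LE t tL; rewrite !inE.
  by case: eqP tL sL => // -> ->.
apply/subsetP => t tL; have := LE t; rewrite !inE tL orbT => /(_ isT).
by case: eqP tL sL => // -> ->.
Qed.

(** Encodes the linear form sum_(t in E) c_t y_t. Its transfer is a constant, and every constant in
    the ideal of the x_t with t in E arises in this way. *)
Definition unitvec (c : 'I_m -> R) E L : R :=
  \sum_(t in E) (if L == [set t] then c t else 0).

Lemma unitvec0 c E L : (forall t, t \in E -> L != [set t]) -> unitvec c E L = 0.
Proof. by move=> LE; apply: big1 => t /LE /negbTE ->. Qed.

Lemma transfer_unitvec c E L :
  transfer (unitvec c E) L = if L == set0 then \sum_(t in E) x t * c t else 0.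
Proof.
rewrite /transfer; under eq_bigr do rewrite big_distrr /=.
rewrite exchange_big /= (eq_bigr (fun t => if L == set0 then x t * c t else 0)).
  by case: eqP => // _; rewrite big1.
move=> t tE; rewrite big_mkcond (bigD1 [set t]) //= big1 ?addr0 => [|A /negbTE ->].
  rewrite properEneq subset1 eqxx; case: (eqVneq L set0) => [->|L0] /=; last first.
    by rewrite orbF; case: eqP.
  rewrite orbT andbT setD0 xmon1 ifT //.
  by apply/eqP => /setP/(_ t); rewrite !inE eqxx.
by rewrite mulr0; case: ifP.
Qed.

Lemma in_span_xmon E A r : A != set0 -> A \subset E -> in_span E (xmon A * r).
Proof.
case/set0Pn => s sA AE; exists (fun t => if t == s then xmon (A :\ s) * r else 0).
rewrite (bigD1 s) ?(subsetP AE) //= eqxx big1 ?addr0 ?mulrA -?xmonD1 //.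
by move=> t /andP[_ /negbTE ->]; rewrite mulr0.
Qed.

Lemma in_spanD E a b : in_span E a -> in_span E b -> in_span E (a + b).
Proof.
move=> [c ->] [d ->]; exists (fun t => c t + d t); rewrite -big_split /=.
by apply: eq_bigr => t _; rewrite mulrDr.
Qed.

Lemma in_span0 E : in_span E 0.
Proof. by exists (fun=> 0); rewrite big1 // => t _; rewrite mulr0. Qed.

Lemma in_spanM E a b : in_span E b -> in_span E (a * b).
Proof.
move=> [c ->]; exists (fun t => a * c t); rewrite big_distrr /=.
by apply: eq_bigr => t _; rewrite mulrCA.
Qed.

Lemma transfer_set0_in_span E f : supp_in E f -> in_span E (transfer f set0).
Proof.
move=> fE; apply: (big_ind (in_span E)); [exact: in_span0|exact: in_spanD|move=> A].
rewrite proper0 setD0 => A0; case: (boolP (A \subset E)) => [|/fE ->].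
  exact: in_span_xmon.
by rewrite mulr0; exact: in_span0.
Qed.

(** Regularity in every order of the x_t, which suits an induction that removes an arbitrary s from
    E. *)
Hypothesis regular_x :
  forall E s r, s \notin E -> in_span E (x s * r) -> in_span E r.

Let eq_of_addr0 (a b : R) : a + b = 0 -> a = b.
Proof. by move=> ab; rewrite -[a]addr0 -(addxx b) addrA ab add0r. Qed.

(* Tate cohomology of C_2 acting on the span of the y^A is generated by y^0:
   an invariant is a transfer up to its constant coefficient. *)
Lemma transfer_exact E f : supp_in E f -> (forall L, transfer f L = 0) ->
  exists2 g, supp_in E g & forall L, L != set0 -> f L = transfer g L.
Proof.
move: {2}#|E| (erefl #|E|) => n; elim: n E f => [|n IHn] E f.
  move/eqP; rewrite cards_eq0 => /eqP -> f0 _; exists (fun=> 0) => // L L0.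
  by rewrite f0 ?subset0 // /transfer big1 // => A _; rewrite mulr0.
move=> cE fE Df0.
have [s sE] : exists s, s \in E by apply/set0Pn; rewrite -card_gt0 cE.
set E' := E :\ s; have cE' : #|E'| = n by move: cE; rewrite (cardsD1 s) sE => -[].
have defE : E = s |: E' by rewrite setD1K.
have sE' : s \notin E' by rewrite !inE eqxx.
have subs g : supp_in E' g -> supp_in (~: [set s]) g.
  move=> gE A sA; apply: gE; apply: contra sA => /subset_trans -> //.
  by rewrite subsetC sub1set inE.
have [f0 [h [fE0 f0s hs]]] := glueK s f.
rewrite {1}defE in fE; move=> /(_ _ fE) [f0E' hE'].
have Dh L : transfer h L = 0.
  have [sL|sL] := boolP (s \in L).
    by apply: transfer_supp hs _; rewrite subsetC sub1set !inE sL.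
  rewrite -[RHS](Df0 (s |: L)) (@eq_transfer f (glue s f0 h)) //.
  by rewrite transfer_glue_in ?setU11 // setU1K.
have Df L : s \notin L -> transfer f0 L = x s * h L.
  move=> sL; apply: eq_of_addr0; rewrite -[RHS](Df0 L) (@eq_transfer f (glue s f0 h)) //.
  by rewrite transfer_glue_out // Dh addr0.
have [u0 u0E' hu0] := IHn E' h cE' hE' Dh.
(* [u0] misses [h] only in the constant coefficient. Multiplied by x_s, this defect becomes a
   combination of constant coefficients of transfers, so it lies in the ideal of the x_t with t in
   E', modulo which x_s is regular. *)
have [c rE] : in_span E' (h set0 + transfer u0 set0).
  apply: (@regular_x E' s) => //; rewrite mulrDr; apply: in_spanD.
    by rewrite -Df ?inE //; apply: transfer_set0_in_span.
  by apply/in_spanM/transfer_set0_in_span.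
pose u L := u0 L + unitvec c E' L.
have uE' : supp_in E' u.
  move=> A AE; rewrite /u u0E' // add0r unitvec0 // => t tE.
  by apply: contra AE => /eqP ->; rewrite sub1set.
have hu L : h L = transfer u L.
  rewrite transferD transfer_unitvec; have [->|L0] := eqVneq.
    by rewrite -rE addrCA addxx addr0.
  by rewrite addr0 hu0.
(* Since (sigma - 1)(f0) = x_s h = x_s (sigma - 1)(u), the element f0 + x_s u is again invariant,
   and it is free of y_s. *)
have [|L|v vE' fv] := IHn E' (fun L => f0 L + x s * u L) cE'.
- by move=> A AE; rewrite f0E' ?uE' // mulr0 addr0.
- rewrite transferD transferZ -hu; have [sL|sL] := boolP (s \in L).
    have LE' : ~~ (L \subset E') by apply/subsetPn; exists s.
    by rewrite (transfer_supp _ _ _ f0E') ?hE' // mulr0 addr0.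
  by rewrite Df // addxx.
have vxuE' : supp_in E' (fun L => v L + x s * u L).
  by move=> A AE; rewrite vE' ?uE' // mulr0 addr0.
(* The witness is v + sigma(y_s) u. In characteristic 2, (sigma - 1)(sigma(y_s) u) = y_s (u + h) +
   (y_s + x_s) u = y_s h + x_s u. Adding (sigma - 1)(v), which is f0 + x_s u up to a constant,
   leaves f0 + y_s h = f up to a constant. *)
exists (glue s (fun L => v L + x s * u L) u) => [A|L L0].
  move=> AE; rewrite /glue; case: ifP => sA.
    apply: uE'; apply: contra AE => /subsetP AE; apply/subsetP => t tA.
    rewrite defE; have := AE t; rewrite !inE tA andbT.
    by case: (t == s) => //= /(_ isT).
  by apply: vxuE'; apply: contra AE => /subset_trans -> //; apply: subD1set.
rewrite fE0; have [sL|sL] := boolP (s \in L).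
  by rewrite transfer_glue_in ?/glue ?sL ?hu //; apply: subs.
rewrite transfer_glue_out ?/glue ?(negbTE sL) //; try exact: subs.
rewrite transferD transferZ mulrDr addrCA -addrA addxx addr0 addrC.
by rewrite -fv // -addrA addxx addr0.
Qed.

End Transfer.

Arguments xmon {R m} x A.
Arguments transfer {R m} x f L.
Arguments unitvec {R m} c E L.
Arguments in_span {R m} x E r.

(** * The type I and type II identities between traces *)

Section Relations.
Variables (S : comNzRingType) (m : nat) (x y : 'I_m -> S).
Hypothesis addxx : forall a : S, a + a = 0.
Implicit Types A B I J K L : {set 'I_m}.

Let oppxx a : - a = a :> S.
Proof. by rewrite -[LHS]addr0 -(addxx a) addKr. Qed.

Let y' s := y s + x s.

Lemma xmonM (f g : 'I_m -> S) A : xmon (fun s => f s * g s) A = xmon f A * xmon g A.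
Proof. exact: big_split. Qed.

Lemma xmonU (f : 'I_m -> S) A B : [disjoint A & B] -> xmon f (A :|: B) = xmon f A * xmon f B.
Proof.
by move=> dAB; rewrite -bigU //=; apply: eq_bigl => s; rewrite !inE.
Qed.

Lemma eq_xmon (f g : 'I_m -> S) A : f =1 g -> xmon f A = xmon g A.
Proof. by move=> fg; apply: eq_bigr => s _. Qed.

Lemma xmonD (f g : 'I_m -> S) A :
  xmon (fun s => f s + g s) A =
  \sum_(L : {set 'I_m} | L \subset A) xmon g (A :\: L) * xmon f L.
Proof.
rewrite /xmon big_mkcond.
rewrite (eq_bigr (fun s => (if s \in A then f s else 0) + (if s \in A then g s else 1))); last first.
  by move=> s _; case: ifP; rewrite ?add0r.
rewrite bigA_distr [RHS]big_mkcond; apply: eq_bigr => L _; case: ifP => LA.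
  rewrite mulrC [X in _ = X * _]big_mkcond [X in _ = _ * X]big_mkcond -big_split.
  apply: eq_bigr => s _; rewrite !inE; case: (boolP (s \in L)) => [/(subsetP LA) ->|_] /=.
    by rewrite mulr1.
  by rewrite mul1r.
by have [s sL sA] := subsetPn (negbT LA); rewrite (bigD1 s) //= sL (negbTE sA) mul0r.
Qed.

Definition trace A : S := xmon y A + xmon y' A.

Lemma trace0 : trace set0 = 0.
Proof. by rewrite /trace /xmon !big_set0 addxx. Qed.

Lemma trace1 s : trace [set s] = x s.
Proof. by rewrite /trace !xmon1 /y' addrA addxx add0r. Qed.

Lemma xmon_shift A :
  xmon y' A = \sum_(L : {set 'I_m} | L \subset A) xmon x (A :\: L) * xmon y L.
Proof. exact: xmonD. Qed.

(** As sigma is an involution, y = y' + x, and the expansion is symmetric in y and y'. *)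
Lemma xmon_unshift A :
  xmon y A = \sum_(L : {set 'I_m} | L \subset A) xmon x (A :\: L) * xmon y' L.
Proof. by rewrite -xmonD; apply: eq_xmon => s; rewrite /y' -addrA addxx addr0. Qed.

Lemma sum_subset_proper (F : {set 'I_m} -> S) A :
  \sum_(L : {set 'I_m} | L \subset A) F L = F A + \sum_(L : {set 'I_m} | L \proper A) F L.
Proof.
rewrite (bigD1 A) //=; congr (_ + _).
by apply: eq_bigl => L; rewrite properEneq andbC.
Qed.

Lemma trace_expand A :
  trace A = \sum_(L : {set 'I_m} | L \proper A) xmon x (A :\: L) * xmon y L.
Proof.
rewrite /trace xmon_shift sum_subset_proper setDv {2}/xmon big_set0 mul1r.
by rewrite addrA addxx add0r.
Qed.

(** By the two expansions the sum over all L <= A is y'^A + y^A = tr(A), which is also its term L =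
    A. What remains vanishes, and the term L = 0 is itself zero. *)
Lemma typeI_trace A : A != set0 ->
  \sum_(L : {set 'I_m} | (set0 \proper L) && (L \proper A)) xmon x (A :\: L) * trace L = 0.
Proof.
move=> A0; transitivity (\sum_(L : {set 'I_m} | L \proper A) xmon x (A :\: L) * trace L).
  rewrite [RHS](bigD1 set0) ?proper0 //= trace0 mulr0 add0r.
  by apply: eq_bigl => L; rewrite proper0 andbC.
have := sum_subset_proper (fun L => xmon x (A :\: L) * trace L) A.
rewrite setDv {2}/xmon big_set0 mul1r; under eq_bigr do rewrite mulrDr.
rewrite big_split /= -xmon_shift -xmon_unshift addrC -/(trace A).
by move/(canLR (addKr _)); rewrite addNr.
Qed.

(** Completed by L = J, the sum is y'^J y^K + y^J y'^K, the cross terms of the product. The term L =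
    J supplies the other two, y^J y^K + y'^J y'^K. *)
Lemma sum_trace_setU J K : [disjoint J & K] ->
  \sum_(L : {set 'I_m} | L \proper J) xmon x (J :\: L) * trace (L :|: K) =
  trace J * trace K.
Proof.
move=> dJK.
have dLK L : L \subset J -> [disjoint L & K] by move/disjointWl; apply.
have /(canLR (addKr _)) <- :=
  sum_subset_proper (fun L => xmon x (J :\: L) * trace (L :|: K)) J.
rewrite setDv {1}/xmon big_set0 mul1r.
rewrite (eq_bigr (fun L => xmon x (J :\: L) * xmon y L * xmon y K
                        + xmon x (J :\: L) * xmon y' L * xmon y' K)); last first.
  by move=> L /dLK dL; rewrite /trace !xmonU // mulrDr !mulrA.
rewrite big_split /= -!big_distrl /= -xmon_shift -xmon_unshift /trace !xmonU //.
by rewrite oppxx; ring.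
Qed.

(** Both y_s and y'_s satisfy z^2 = N_s + x_s z, so the sum completed by L = I collapses to terms in
    the squares of y^I and y'^I. With N^I = y^I y'^I, a polynomial identity in the monomials over I,
    J, K is left. *)
Lemma typeII_trace A B :
  let I := A :&: B in let J := A :\: B in let K := B :\: A in
  let N s := y s ^+ 2 + x s * y s in
  trace A * trace B
  + \sum_(L : {set 'I_m} | L \proper I)
      xmon x (I :\: L) * xmon N L * trace ((I :\: L) :|: J :|: K)
  + xmon N I * \sum_(L : {set 'I_m} | L \proper J) xmon x (J :\: L) * trace (L :|: K) = 0.
Proof.
move=> I J K N.
have dJK : [disjoint J & K].
  by rewrite -setI_eq0; apply/eqP/setP => t; rewrite !inE; do 2!case: (_ \in _).
have dIJ : [disjoint I & J].
  by rewrite -setI_eq0; apply/eqP/setP => t; rewrite !inE; do 2!case: (_ \in _).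
have dIK : [disjoint I & K].
  by rewrite -setI_eq0; apply/eqP/setP => t; rewrite !inE; do 2!case: (_ \in _).
have dIJK : [disjoint I & J :|: K].
  by rewrite -setI_eq0; apply/eqP/setP => t; rewrite !inE; do 2!case: (_ \in _).
rewrite sum_trace_setU //.
have sq (z : 'I_m -> S) : (forall s, z s ^+ 2 = N s + x s * z s) ->
    xmon z I * xmon z I =
    \sum_(L : {set 'I_m} | L \subset I) xmon x (I :\: L) * xmon N L * xmon z (I :\: L).
  move=> zN; rewrite -xmonM (eq_xmon _ (fun s => N s + x s * z s)); last first.
    by move=> s; rewrite -expr2.
  by rewrite xmonD; apply: eq_bigr => L _; rewrite xmonM mulrAC.
have yN s : y s ^+ 2 = N s + x s * y s by rewrite /N -addrA addxx addr0.
have y'N s : y' s ^+ 2 = N s + x s * y' s.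
  rewrite /N /y'; transitivity (y s ^+ 2 + (x s * y s + x s * y s) + x s ^+ 2); first by ring.
  ring.
have NI : xmon N I = xmon y I * xmon y' I.
  by rewrite -xmonM; apply: eq_xmon => s; rewrite /N /y'; ring.
have -> : \sum_(L : {set 'I_m} | L \proper I)
      xmon x (I :\: L) * xmon N L * trace ((I :\: L) :|: J :|: K) =
    xmon y I * xmon y I * xmon y J * xmon y K + xmon y' I * xmon y' I * xmon y' J * xmon y' K
    - xmon N I * trace (J :|: K).
  have /(canLR (addKr _)) <- := sum_subset_proper
     (fun L => xmon x (I :\: L) * xmon N L * trace ((I :\: L) :|: J :|: K)) I.
  rewrite setDv {1}/xmon big_set0 mul1r set0U addrC; congr (_ - _).
  rewrite (sq y yN) (sq y' y'N) !big_distrl -big_split /=; apply: eq_bigr => L _.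
  have dL : [disjoint I :\: L & J :|: K] by apply: disjointWl dIJK; apply: subsetDl.
  by rewrite -setUA /trace !xmonU //; ring.
rewrite -(setID A B) -/I -/J /trace.
have -> : B = I :|: K by rewrite -{1}(setID B A) setIC.
rewrite !xmonU // NI oppxx.
set a := xmon y I; set a' := xmon y' I; set b := xmon y J; set b' := xmon y' J.
set c := xmon y K; set c' := xmon y' K.
(* Each of the six monomials of the expansion occurs exactly twice; [w] collects one copy of
   each. *)
transitivity (let w := a * b * (a * c) + a' * b' * (a' * c') + a * b * (a' * c') + a' * b' * (a * c)
  + a * a' * (b * c + b' * c') in w + w); first by rewrite /=; ring.
exact: addxx.
Qed.

End Relations.

Arguments trace {S m} x y A.

(** * Leading monomials, substitutions, and regularity of the x_s in S *)

Lemma mpoly_ring_ind (R : nzRingType) (n : nat) (P : {mpoly R[n]} -> Prop) :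
  (forall c, P c%:MP) -> (forall p q, P p -> P q -> P (p + q)) ->
  (forall i p, P p -> P ('X_i * p)) -> forall p, P p.
Proof.
move=> PC PD PX; elim/mpolyind => [|c mon p _ _ Pp]; first by rewrite -mpolyC0.
apply: PD Pp; rewrite -mul_mpolyC commr_mpolyX mpolyXE_id.
apply: (big_rec (fun q => P (q * c%:MP))) => [|i q _ Pq]; first by rewrite mul1r.
elim: (mon i) => [|k IHk]; first by rewrite mul1r.
by rewrite exprS -!mulrA; apply: PX; rewrite mulrA.
Qed.

Lemma seq_argmax (d : Order.disp_t) (T : orderType d) (I : eqType) (f : I -> T) (s : seq I) :
  s != [::] -> exists2 i, i \in s & forall j, j \in s -> (f j <= f i)%O.
Proof.
elim: s => // a [|b s] IHs _; first by exists a => [|j]; rewrite inE // => /eqP ->.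
have [//|i si fi] := IHs; case: (leP (f i) (f a)) => fai.
  exists a; first by rewrite inE eqxx.
  by move=> j; rewrite in_cons => /predU1P[->//|/fi /le_trans]; apply.
exists i; first by rewrite in_cons si orbT.
by move=> j; rewrite in_cons => /predU1P[->|/fi//]; apply: ltW.
Qed.

(** Among the terms with nonzero coefficient, the largest leading monomial occurs in one term only
    and cannot cancel. *)
Lemma mlead_free (F : fieldType) (n : nat) (I : eqType) (s : seq I)
    (c : I -> F) (b : I -> {mpoly F[n]}) :
  uniq s -> (forall i, b i != 0) -> injective (fun i => mlead (b i)) ->
  \sum_(i <- s) c i *: b i = 0 -> forall i, i \in s -> c i = 0.
Proof.
move=> us b0 binj bs0 i0 i0s; apply/eqP; apply: contraTT isT => ci0.
pose s' := [seq i <- s | c i != 0].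
have [|i] := @seq_argmax _ _ _ (fun i => mlead (b i)) s'.
  by rewrite -has_filter; apply/hasP; exists i0.
rewrite mem_filter => /andP[cin0 si] imax.
have := congr1 (mcoeff (mlead (b i))) bs0.
rewrite raddf_sum /= mcoeff0 (bigD1_seq i) //= big1_seq => [|j /andP[ji sj]].
  by rewrite addr0 mcoeffZ => /eqP; rewrite mulf_eq0 (negbTE cin0) mleadc_eq0 (negbTE (b0 i)).
rewrite mcoeffZ; have [->|cj] := eqVneq (c j) 0; first by rewrite mul0r.
rewrite mcoeff_gt_mlead ?mulr0 // lt_neqAle imax ?mem_filter ?cj ?sj // andbT.
by apply: contra ji => /eqP/binj ->.
Qed.

Section Polynomials.
Variables (F : fieldType) (m : nat).
Implicit Types (E A B L : {set 'I_m}) (s t : 'I_m) (p q r : {mpoly F[m + m]}).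

Local Notation S := {mpoly F[m + m]}.
Local Notation X := (@Sx F m).
Local Notation Y := (@Sy F m).

Lemma Sring_ind (P : S -> Prop) :
  (forall c, P c%:MP) -> (forall p q, P p -> P q -> P (p + q)) ->
  (forall s p, P p -> P (X s * p)) -> (forall s p, P p -> P (Y s * p)) ->
  forall p, P p.
Proof.
move=> PC PD PX PY; apply: mpoly_ring_ind => // i p.
by rewrite -(splitK i); case: (split i) => s /=; [apply: PX | apply: PY].
Qed.

Definition eval2 (n : nat) (u v : 'I_m -> {mpoly F[n]}) : S -> {mpoly F[n]} :=
  mmap (@mpolyC n F) (fun i => match split i with inl s => u s | inr s => v s end).

Section Eval2.
Variables (n : nat) (u v : 'I_m -> {mpoly F[n]}).

HB.instance Definition _ := GRing.RMorphism.on (eval2 n u v).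

Lemma eval2C c : eval2 n u v c%:MP = c%:MP.
Proof. by rewrite /eval2 mmapC. Qed.

Lemma eval2X s : eval2 n u v (X s) = u s.
Proof. by rewrite /eval2 /Sx mmapX mmap1U (unsplitK (inl s)). Qed.

Lemma eval2Y s : eval2 n u v (Y s) = v s.
Proof. by rewrite /eval2 /Sy mmapX mmap1U (unsplitK (inr s)). Qed.

End Eval2.

(** The substitution [k] kills the x_t with t in E and fixes the other variables. It is the identity
    modulo the ideal of these x_t and sends that ideal to 0, so the hypothesis becomes x_s * k r = 0
    in a domain. *)
Lemma Sx_regular E s r : s \notin E -> in_span X E (X s * r) -> in_span X E r.
Proof.
move=> sE; pose k : {rmorphism S -> S} := eval2 _ (fun t => if t \in E then 0 else X t) Y.
have kX t : k (X t) = if t \in E then 0 else X t by exact: eval2X.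
have in_kerP p : in_span X E (p - k p).
  elim/Sring_ind: p => [c|p q Ep Eq|t p Ep|t p Ep].
  - have -> : k c%:MP = c%:MP by exact: eval2C.
    by rewrite subrr; apply: in_span0.
  - by rewrite rmorphD opprD addrACA; apply: in_spanD.
  - rewrite rmorphM kX; case: ifP => tE.
      have := @in_span_xmon _ _ X E [set t] p; rewrite xmon1 mul0r subr0; apply.
        by apply/set0Pn; exists t; rewrite inE.
      by rewrite sub1set.
    by rewrite -mulrBr; apply: in_spanM.
  - have kY : k (Y t) = Y t by exact: eval2Y.
    by rewrite rmorphM kY -mulrBr; apply: in_spanM.
case=> c defr; have kr : X s * k r = 0.
  have := congr1 k defr; rewrite rmorphM kX (negbTE sE) rmorph_sum => ->.
  by apply: big1 => t tE; rewrite rmorphM kX tE mul0r.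
have {}kr : k r = 0.
  apply/eqP; move/eqP: kr; rewrite mulf_eq0 => /orP[|//].
  by rewrite -msupp_eq0 msuppX.
by rewrite -[r]subr0 -kr.
Qed.

End Polynomials.

Arguments eval2 {F m n} u v.
Arguments eval2C {F m n} u v.
Arguments eval2X {F m n} u v.
Arguments eval2Y {F m n} u v.

(** * Linear independence of the y^A over R = F[x, N] *)

Section Independence.
Variables (F : fieldType) (m : nat).
Implicit Types (E A B L : {set 'I_m}) (s t : 'I_m) (p q r : {mpoly F[m + m]}).

Local Notation S := {mpoly F[m + m]}.
Local Notation X := (@Sx F m).
Local Notation Y := (@Sy F m).

(* S is also used as a copy of R = F[x, N], with Y s standing for N_s; embN is then
   the inclusion of R in S, and embQ below its inclusion in Q. *)
Definition embN : S -> S := eval2 X (fun s => Y s ^+ 2 + X s * Y s).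

HB.instance Definition _ := GRing.RMorphism.on embN.

(* The monomial order makes X s larger than Y s; in the swapped coordinates the
   norm becomes X s ^+ 2 + Y s * X s, whose leading monomial is X s ^+ 2. *)
Let swap : {rmorphism S -> S} := eval2 Y X.
Let swap_embN : {rmorphism S -> S} := swap \o embN.

Let swap_embNC c : swap_embN c%:MP = c%:MP.
Proof. by rewrite /= /embN !eval2C. Qed.

Let swap_embNZ c p : swap_embN (c *: p) = c *: swap_embN p.
Proof. by rewrite -mul_mpolyC (rmorphM swap_embN) swap_embNC mul_mpolyC. Qed.

Let swap_embNX s : swap_embN (X s) = Y s.
Proof. by rewrite /= /embN !eval2X. Qed.

Let swap_embNY s : swap_embN (Y s) = X s * (X s + Y s).
Proof.
have sX : swap (X s) = Y s by exact: eval2X.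
have sY : swap (Y s) = X s by exact: eval2Y.
by rewrite /= {1}/embN eval2Y rmorphD rmorphXn rmorphM sX sY mulrDr expr2 [Y s * _]mulrC.
Qed.

Let mleadXY s : mlead (X s + Y s) = U_(lshift m s)%MM.
Proof.
rewrite mleadDl !mleadXm //; apply/ltmcP; first by rewrite !mdeg1.
exists (lshift m s) => [j|]; rewrite !mnm1E.
  by move=> js; rewrite -!val_eqE /= !gtn_eqF // (leq_trans js) // leq_addl.
by rewrite eqxx -val_eqE /= gtn_eqF // ltn_addr.
Qed.

Lemma mpolyXU_neq0 (n : nat) (i : 'I_n) : ('X_i : {mpoly F[n]}) != 0.
Proof. by rewrite -msupp_eq0 msuppX. Qed.

Let XY_neq0 s : X s + Y s != 0.
Proof.
apply/eqP => XY0; have := mleadXY s; rewrite XY0 mlead0.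
by move/(congr1 (fun mon : 'X_{1.. m + m} => mdeg mon)); rewrite mdeg0 mdeg1.
Qed.

Let swap_embN_var_neq0 i : swap_embN 'X_i != 0.
Proof.
rewrite -(splitK i); case: (split i) => s; rewrite -/(X s) -/(Y s).
  by rewrite swap_embNX mpolyXU_neq0.
by rewrite swap_embNY mulf_neq0 ?mpolyXU_neq0.
Qed.

Let mlead_swap_embNX s : mlead (swap_embN (X s)) = U_(rshift m s)%MM.
Proof. by rewrite swap_embNX mleadXm. Qed.

Let mlead_swap_embNY s : mlead (swap_embN (Y s)) = (U_(lshift m s) *+ 2)%MM.
Proof. by rewrite swap_embNY mleadM ?mpolyXU_neq0 // mleadXm mleadXY mulmS mulm1n. Qed.

Let swap_embNXn k n : swap_embN ('X_k ^+ n) = swap_embN 'X_k ^+ n.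
Proof. exact: rmorphXn. Qed.

Let swap_embN_mon (k : 'X_{1.. m + m}) : swap_embN 'X_[k] = \prod_i swap_embN 'X_i ^+ k i.
Proof.
rewrite mpolyXE_id (rmorph_prod swap_embN); apply: eq_bigr => i _.
exact: swap_embNXn.
Qed.

(** In swapped coordinates, the product of the monomial of F[x, N] with exponent [i.2] and of y^A
    with A = [i.1]. *)
Let b (i : {set 'I_m} * 'X_{1.. m + m}) : S := swap_embN 'X_[i.2] * xmon X i.1.

Let b_neq0 i : b i != 0.
Proof.
rewrite mulf_neq0 // ?swap_embN_mon.
  by apply/prodf_neq0 => k _; apply/expf_neq0/swap_embN_var_neq0.
by apply/prodf_neq0 => k _; rewrite mpolyXU_neq0.
Qed.

Let mlead_b i : mlead (b i) =
  ((\sum_(s < m) (U_(rshift m s) *+ i.2 (lshift m s)))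
  + (\sum_(s < m) (U_(lshift m s) *+ 2 *+ i.2 (rshift m s)))
  + \sum_(s in i.1) U_(lshift m s))%MM.
Proof.
have := b_neq0 i; rewrite mulf_eq0 negb_or => /andP[n1 n2].
rewrite mleadM //; congr (_ + _)%MM; last first.
  rewrite mlead_prod => [|s _ _]; last exact: mpolyXU_neq0.
  by apply: eq_bigr => s _; rewrite mleadXm.
rewrite swap_embN_mon mlead_prod => [|k _ _]; last first.
  exact/expf_neq0/swap_embN_var_neq0.
rewrite big_split_ord; congr (_ + _)%MM; apply: eq_bigr => s _.
  by rewrite (mleadX _ (swap_embN_var_neq0 _)) -mlead_swap_embNX.
by rewrite (mleadX _ (swap_embN_var_neq0 _)) -mlead_swap_embNY.
Qed.

Let mlead_bl i s : mlead (b i) (lshift m s) = ((i.2 (rshift m s)).*2 + (s \in i.1))%N.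
Proof.
rewrite mlead_b !mnmDE !mnm_sumE big1 => [|t _]; last first.
  by rewrite mulmnE mnm1E eq_rlshift.
rewrite add0n; congr addn.
  rewrite (bigD1 s) //= big1 => [|t ts]; rewrite !mulmnE mnm1E eq_lshift.
    by rewrite eqxx mul1n mul2n addn0.
  by rewrite (negbTE ts).
have [si|si] := boolP (s \in i.1).
  rewrite (bigD1 s) //= mnm1E eqxx big1 // => t /andP[_ ts].
  by rewrite mnm1E eq_lshift (negbTE ts).
rewrite big1 // => t ti; rewrite mnm1E eq_lshift; case: eqP => // ts.
by rewrite -ts ti in si.
Qed.

Let mlead_br i s : mlead (b i) (rshift m s) = i.2 (lshift m s).
Proof.
rewrite mlead_b !mnmDE !mnm_sumE [X in (_ + X)%N]big1 => [|t _]; last first.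
  by rewrite mnm1E eq_lrshift.
rewrite [X in (_ + X + _)%N]big1 => [|t _]; last first.
  by rewrite !mulmnE mnm1E eq_lrshift.
rewrite !addn0 (bigD1 s) //= big1 => [|t ts]; rewrite !mulmnE mnm1E eq_rshift.
  by rewrite eqxx mul1n addn0.
by rewrite (negbTE ts).
Qed.

(** In the leading monomial, the exponent of [X s] is twice that of N_s plus the indicator of s in
    A: its parity recovers A, its half the exponent of N_s. The exponent of [Y s] is that of x_s. *)
Let mlead_b_inj : injective (fun i => mlead (b i)).
Proof.
move=> i j ij; have el s := congr1 (fun k : 'X_{1.. m + m} => k (lshift m s)) ij.
have er s := congr1 (fun k : 'X_{1.. m + m} => k (rshift m s)) ij.
have dbl_inj n n' (c c' : bool) : (n.*2 + c)%N = (n'.*2 + c')%N -> n = n' /\ c = c'.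
  move=> nn'; split; last by have := congr1 odd nn'; rewrite !oddD !odd_double !oddb.
  by have := congr1 half nn'; rewrite ![(_.*2 + _)%N]addnC !half_bit_double.
have {}el s : i.2 (rshift m s) = j.2 (rshift m s) /\ (s \in i.1) = (s \in j.1).
  by apply: dbl_inj; rewrite -!mlead_bl.
case: i j el er {ij} => [A k] [B l] /= el er; congr pair.
  by apply/setP => s; case: (el s).
apply/mnmP => z; rewrite -(splitK z); case: (split z) => s /=; last by case: (el s).
by move: (er s); rewrite !mlead_br.
Qed.

(** Expanding the coefficients into monomials turns independence over R into independence over F of
    the family [b], whose leading monomials are distinct. *)
Lemma embN_free (d : {set 'I_m} -> S) :
  \sum_(A : {set 'I_m}) embN (d A) * xmon Y A = 0 -> forall A, d A = 0.
Proof.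
move=> d0; pose s := [seq (A, k) | A <- enum {set 'I_m}, k <- msupp (d A)].
have {}d0 : \sum_(i <- s) (d i.1)@_i.2 *: b i = 0.
  have := congr1 swap d0; rewrite rmorph0 rmorph_sum => {2}<-.
  rewrite big_allpairs_dep big_enum /=; apply: eq_bigr => A _.
  have -> : swap (embN (d A) * xmon Y A) = swap_embN (d A) * xmon X A.
    rewrite (rmorphM swap) (rmorph_prod swap); congr (_ * _).
    by apply: eq_bigr => t _; rewrite /swap /= eval2Y.
  rewrite {3}[d A]mpolyE (rmorph_sum swap_embN) big_distrl /=; apply: eq_bigr => k _.
  by rewrite scalerAl -swap_embNZ.
have us : uniq s.
  by apply: allpairs_uniq_dep => [|A _|[A k] [B l] _ _ /= [-> ->]] //; rewrite ?enum_uniq ?msupp_uniq.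
move=> A; apply/mpolyP => k; rewrite mcoeff0.
have [kA|/memN_msupp_eq0 //] := boolP (k \in msupp (d A)).
apply: (mlead_free _ _ _ s (fun i => (d i.1)@_i.2) b us b_neq0 mlead_b_inj d0 (A, k)).
by apply/allpairsPdep; exists A, k; rewrite mem_enum.
Qed.

End Independence.

Arguments embN {F m}.

(** * Ideals generated by a finite family *)

Section Ideals.
Variables (R : comNzRingType) (I : finType) (g : I -> R).
Implicit Types p q : R.

Lemma in_ideal0 : in_ideal_gen g 0.
Proof. by exists (fun=> 0); rewrite big1 // => i _; rewrite mul0r. Qed.

Lemma in_idealD p q : in_ideal_gen g p -> in_ideal_gen g q -> in_ideal_gen g (p + q).
Proof.
move=> [c ->] [d ->]; exists (fun i => c i + d i).
by rewrite -big_split; apply: eq_bigr => i _; rewrite mulrDl.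
Qed.

Lemma in_idealM p q : in_ideal_gen g q -> in_ideal_gen g (p * q).
Proof.
move=> [c ->]; exists (fun i => p * c i).
by rewrite mulr_sumr; apply: eq_bigr => i _; rewrite /= mulrA.
Qed.

Lemma in_ideal_mem i : in_ideal_gen g (g i).
Proof.
exists (fun j => if j == i then 1 else 0); rewrite (bigD1 i) //= eqxx mul1r.
by rewrite big1 ?addr0 // => j /negbTE ->; rewrite mul0r.
Qed.

Lemma in_ideal_sum (J : finType) (P : pred J) (G : J -> R) :
  (forall j, P j -> in_ideal_gen g (G j)) -> in_ideal_gen g (\sum_(j | P j) G j).
Proof. by move=> gG; apply: (big_ind (in_ideal_gen g)); [exact: in_ideal0|exact: in_idealD|]. Qed.

End Ideals.

(** * Reduction modulo type II, and the R-linear part of the kernel of pi *)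

Section Presentation.
Variables (F : fieldType) (m : nat).
Hypothesis pchar2 : (2 \in [pchar F])%N.
Implicit Types (E A B L : {set 'I_m}) (s t : 'I_m) (p q r : {mpoly F[m + m]}).

Local Notation S := {mpoly F[m + m]}.
Local Notation X := (@Sx F m).
Local Notation Y := (@Sy F m).
Local Notation Q := (Qring F m).

Lemma mpoly_addxx (n : nat) (a : {mpoly F[n]}) : a + a = 0.
Proof. by apply: addrr_pchar2; apply: (rmorph_pchar (@mpolyC n F)). Qed.

Definition embQ : S -> Q := eval2 (@Qx F m) (@QN F m).

HB.instance Definition _ := GRing.RMorphism.on embQ.

Definition pi_morph : Q -> S := mmap (@mpolyC (m + m) F) (fun i => pi_var F (enum_val i)).

HB.instance Definition _ := GRing.RMorphism.on pi_morph.

Lemma pi_morphE (q : Q) : Defs.pi q = pi_morph q. Proof. by []. Qed.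

Lemma embQC c : embQ c%:MP = c%:MP. Proof. exact: eval2C. Qed.
Lemma embQX s : embQ (X s) = Qx F s. Proof. exact: eval2X. Qed.
Lemma embQY s : embQ (Y s) = QN F s. Proof. exact: eval2Y. Qed.

Lemma pi_Qvar v : pi_morph (Qvar F v) = pi_var F v.
Proof. by rewrite /pi_morph /Qvar mmapX mmap1U enum_rankK. Qed.

Lemma embNX s : embN (X s) = X s. Proof. exact: eval2X. Qed.

Lemma pi_embQ p : pi_morph (embQ p) = embN p.
Proof.
elim/Sring_ind: p => [c|p q Ep Eq|t p Ep|t p Ep].
- by rewrite /embQ /embN !eval2C /pi_morph mmapC.
- by rewrite !rmorphD /= Ep Eq.
- by rewrite !rmorphM /= embQX pi_Qvar Ep /embN eval2X.
- by rewrite !rmorphM /= embQY pi_Qvar Ep /embN eval2Y.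
Qed.

Lemma embQ_xmon A : embQ (xmon X A) = xmon (@Qx F m) A.
Proof. by rewrite rmorph_prod; apply: eq_bigr => s _; exact: embQX. Qed.

Lemma embQ_Npow A : embQ (xmon Y A) = xmon (@QN F m) A.
Proof. by rewrite rmorph_prod; apply: eq_bigr => s _; exact: embQY. Qed.

Lemma Tr_ge2 A (cA : (2 <= #|A|)%N) : Tr F A = Qvar F (inr (exist _ A cA)).
Proof. by rewrite /Tr insubT. Qed.

Lemma Tr0 : Tr F (@set0 'I_m) = 0.
Proof. by rewrite /Tr insubF ?cards0 //; case: pickP => // s; rewrite inE. Qed.

Lemma Tr1 s : Tr F [set s] = Qx F s.
Proof.
rewrite /Tr insubF ?cards1 //; case: pickP => [t|/(_ s)]; rewrite inE ?eqxx //.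
by move/eqP->.
Qed.

Lemma Tr_cases A :
  [\/ A = set0, exists s, A = [set s] | exists cA : (2 <= #|A|)%N, true].
Proof.
case cA : #|A| => [|[|n]]; [apply: Or31 | apply: Or32 | by apply: Or33; exists isT].
  by apply/eqP; rewrite -cards_eq0 cA.
by apply/cards1P; rewrite cA.
Qed.

Lemma pi_Tr A : pi_morph (Tr F A) = trace X Y A.
Proof.
case: (Tr_cases A) => [->|[s ->]|[cA _]].
- by rewrite Tr0 rmorph0 trace0 //; apply: mpoly_addxx.
- by rewrite Tr1 pi_Qvar trace1 //; apply: mpoly_addxx.
- by rewrite Tr_ge2 pi_Qvar.
Qed.

Lemma pi_xpow A : pi_morph (xpow F A) = xmon X A.
Proof. by rewrite rmorph_prod; apply: eq_bigr => s _; exact: pi_Qvar. Qed.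

Lemma pi_Npow A : pi_morph (Npow F A) = xmon (fun s => Y s ^+ 2 + X s * Y s) A.
Proof. by rewrite rmorph_prod; apply: eq_bigr => s _; exact: pi_Qvar. Qed.

Lemma pi_rho A : A != set0 -> pi_morph (rho F A) = 0.
Proof.
move=> A0; rewrite rmorph_sum -[RHS](typeI_trace _ _ X Y (@mpoly_addxx _) A A0).
by apply: eq_bigr => L _; rewrite rmorphM /= pi_xpow pi_Tr.
Qed.

Lemma pi_typeII A B : pi_morph (typeII F A B) = 0.
Proof.
rewrite -[RHS](typeII_trace _ _ X Y (@mpoly_addxx _) A B) /typeII !rmorphD.
rewrite !rmorphM !rmorph_sum /= !pi_Tr pi_Npow; congr (_ + _ + _ * _).
  by apply: eq_bigr => L _; rewrite !rmorphM /= pi_xpow pi_Npow pi_Tr.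
by apply: eq_bigr => L _; rewrite !rmorphM /= pi_xpow pi_Tr.
Qed.

(** Normal forms modulo type II. They are not unique: A also runs over the singletons, although
    Tr({t}) = x_t already lies in R, and this freedom is what later absorbs c. *)
Definition Rlin_Tr (q : Q) := exists c (d : {set 'I_m} -> S),
  q = embQ c + \sum_(A : {set 'I_m}) embQ (d A) * Tr F A.

Lemma Rlin_embQ c : Rlin_Tr (embQ c).
Proof.
by exists c, (fun=> 0); rewrite big1 ?addr0 // => A _; rewrite rmorph0 mul0r.
Qed.

Lemma Rlin_Tr_Tr A : Rlin_Tr (Tr F A).
Proof.
exists 0, (fun B => if B == A then 1 else 0).
rewrite rmorph0 add0r (bigD1 A) //= eqxx rmorph1 mul1r big1 ?addr0 // => B /negbTE ->.
by rewrite rmorph0 mul0r.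
Qed.

Lemma Rlin_TrD a b : Rlin_Tr a -> Rlin_Tr b -> Rlin_Tr (a + b).
Proof.
move=> [c [d ->]] [c' [d' ->]]; exists (c + c'), (fun A => d A + d' A).
rewrite rmorphD addrACA -big_split; congr (_ + _); apply: eq_bigr => A _.
by rewrite rmorphD mulrDl.
Qed.

Lemma Rlin_TrM r a : Rlin_Tr a -> Rlin_Tr (embQ r * a).
Proof.
move=> [c [d ->]]; exists (r * c), (fun A => r * d A).
rewrite mulrDr rmorphM; congr (_ + _); rewrite mulr_sumr; apply: eq_bigr => A _.
by rewrite rmorphM mulrA.
Qed.

Lemma Rlin_Tr_sum (J : finType) (P : pred J) (G : J -> Q) :
  (forall j, P j -> Rlin_Tr (G j)) -> Rlin_Tr (\sum_(j | P j) G j).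
Proof.
move=> VG; apply: (big_ind Rlin_Tr) VG; last exact: Rlin_TrD.
by rewrite -(rmorph0 embQ); apply: Rlin_embQ.
Qed.

Lemma typeII_Rlin A B : Rlin_Tr (typeII F A B - Tr F A * Tr F B).
Proof.
rewrite /typeII addrC !addrA addNr add0r; apply: Rlin_TrD.
  apply: Rlin_Tr_sum => L _; rewrite -mulrA -[xpow _ _]embQ_xmon -[Npow _ _]embQ_Npow.
  by do 2!apply: Rlin_TrM; apply: Rlin_Tr_Tr.
rewrite -[Npow _ _]embQ_Npow; apply: Rlin_TrM; apply: Rlin_Tr_sum => L _.
by rewrite -[xpow _ _]embQ_xmon; apply: Rlin_TrM; apply: Rlin_Tr_Tr.
Qed.

Section Reduction.
Variables (I : finType) (g : I -> Q).
Hypothesis g_typeII : forall A B, (2 <= #|A|)%N -> (2 <= #|B|)%N ->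
  in_ideal_gen g (typeII F A B) \/ in_ideal_gen g (typeII F B A).

Definition reducible (q : Q) := exists2 a, Rlin_Tr a & in_ideal_gen g (q - a).

Lemma Rlin_reducible a : Rlin_Tr a -> reducible a.
Proof. by exists a; rewrite ?subrr //; apply: in_ideal0. Qed.

Lemma reducibleD a b : reducible a -> reducible b -> reducible (a + b).
Proof.
move=> [a' Va Ia] [b' Vb Ib]; exists (a' + b'); first exact: Rlin_TrD.
by rewrite opprD addrACA; apply: in_idealD.
Qed.

Lemma reducibleM r a : reducible a -> reducible (embQ r * a).
Proof.
move=> [a' Va Ia]; exists (embQ r * a'); first exact: Rlin_TrM.
by rewrite -mulrBr; apply: in_idealM.
Qed.

Lemma reducible_sum (J : finType) (P : pred J) (G : J -> Q) :
  (forall j, P j -> reducible (G j)) -> reducible (\sum_(j | P j) G j).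
Proof.
move=> VG; apply: (big_ind reducible) VG; last exact: reducibleD.
by rewrite -(rmorph0 embQ); apply/Rlin_reducible/Rlin_embQ.
Qed.

Lemma reducible_TrTr A B : reducible (Tr F A * Tr F B).
Proof.
(* If C has fewer than two elements, [Tr C] is 0 or some x_s, an element of R, and the product is
   already R-linear. *)
have low C D : [\/ C = set0, exists s, C = [set s] | exists cA : (2 <= #|C|)%N, true] ->
    (2 <= #|C|)%N \/ reducible (Tr F C * Tr F D).
  case=> [->|[s ->]|[cC _]]; [right | right | by left].
    by rewrite Tr0 -(rmorph0 embQ); apply/reducibleM/Rlin_reducible/Rlin_Tr_Tr.
  by rewrite Tr1 -embQX; apply/reducibleM/Rlin_reducible/Rlin_Tr_Tr.
have [cA|//] := low A B (Tr_cases A).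
have [cB|] := low B A (Tr_cases B); last by rewrite mulrC.
have step C D : in_ideal_gen g (typeII F C D) -> reducible (Tr F C * Tr F D).
  move=> gCD; exists (embQ (- 1) * (typeII F C D - Tr F C * Tr F D)).
    exact/Rlin_TrM/typeII_Rlin.
  by rewrite rmorphN1 mulN1r opprK addrC subrK.
have [/step//|/step] := g_typeII A B cA cB.
by rewrite mulrC.
Qed.

Lemma all_reducible (q : Q) : reducible q.
Proof.
elim/mpoly_ring_ind: q => [c|p q|i p [a Va Ia]].
- rewrite -embQC.
  exact/Rlin_reducible/Rlin_embQ.
- exact: reducibleD.
(* With p replaced by its normal form a, multiplying by one variable creates at worst products of
   two [Tr]. *)
suff [b Vb Ib] : reducible ('X_i * a).
  exists b => //; rewrite -[_ * p](subrK ('X_i * a)) -addrA -mulrBr.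
  by apply: in_idealD => //; apply: in_idealM.
have -> : 'X_i = Qvar F (enum_val i) by rewrite /Qvar enum_valK.
case: (enum_val i) => [[s|s]|[B cB]].
- by rewrite -[Qvar _ _]embQX; apply: reducibleM; apply: Rlin_reducible.
- by rewrite -[Qvar _ _]embQY; apply: reducibleM; apply: Rlin_reducible.
case: Va => c [d ->]; rewrite -Tr_ge2 mulrDr; apply: reducibleD.
  by rewrite mulrC; apply/reducibleM/Rlin_reducible/Rlin_Tr_Tr.
rewrite mulr_sumr; apply: reducible_sum => A _ /=; rewrite mulrCA.
exact/reducibleM/reducible_TrTr.
Qed.

End Reduction.

Lemma transfer_embN d A : embN (transfer X d A) = \sum_(B : {set 'I_m} | A \proper B)
   xmon X (B :\: A) * embN (d B).
Proof.
rewrite rmorph_sum; apply: eq_bigr => B _; rewrite rmorphM rmorph_prod; congr (_ * _).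
by apply: eq_bigr => s _; exact: embNX.
Qed.

(* In the basis y^L, the image of sum_A d_A Tr(A) under pi is the transfer of d. *)
Lemma pi_Rlin c (d : {set 'I_m} -> S) :
  pi_morph (embQ c + \sum_(A : {set 'I_m}) embQ (d A) * Tr F A) = 0 ->
  forall L, transfer X d L = if L == set0 then c else 0.
Proof.
move=> pi0 L; have {}pi0 : \sum_(L : {set 'I_m})
    embN ((if L == set0 then c else 0) + transfer X d L) * xmon Y L = 0.
  rewrite -[RHS]pi0 (rmorphD pi_morph) /= pi_embQ (rmorph_sum pi_morph) /=.
  under eq_bigr do rewrite rmorphD mulrDl.
  rewrite big_split /= (bigD1 set0) //= big1 => [|A /negbTE->]; last first.
    by rewrite rmorph0 mul0r.
  rewrite eqxx addr0 {1}/xmon big_set0 mulr1; congr (_ + _).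
  under eq_bigr do rewrite transfer_embN mulr_suml /=.
  rewrite (exchange_big_dep predT) //=; apply: eq_bigr => A _.
  rewrite rmorphM /= pi_embQ pi_Tr (trace_expand _ _ _ _ (@mpoly_addxx _)) mulr_sumr.
  by apply: eq_bigr => B _ /=; rewrite mulrA [embN _ * _]mulrC.
have /eqP := embN_free _ _ _ pi0 L.
by rewrite addr_eq0 => /eqP ->; apply/eqP; rewrite -addr_eq0 mpoly_addxx.
Qed.

Lemma kernel_Rlin c (d : {set 'I_m} -> S) :
  pi_morph (embQ c + \sum_(A : {set 'I_m}) embQ (d A) * Tr F A) = 0 ->
  exists r : {set 'I_m} -> S,
    embQ c + \sum_(A : {set 'I_m}) embQ (d A) * Tr F A = \sum_A embQ (r A) * rho F A.
Proof.
move=> /pi_Rlin Td; have addxx := @mpoly_addxx (m + m).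
have [e ce] : in_span X setT c.
  have := Td set0; rewrite eqxx => <-; apply: transfer_set0_in_span => A.
  by rewrite subsetT.
have [|L|r _ dr] := transfer_exact _ _ X addxx (@Sx_regular F m) setT
  (fun A => d A + unitvec e setT A).
- by move=> A; rewrite subsetT.
- rewrite transferD transfer_unitvec Td; case: eqP => _; rewrite ?addr0 //.
  by rewrite -ce addxx.
have {ce Td} Ec : embQ c = \sum_(L : {set 'I_m} | L != set0) embQ (unitvec e setT L) * Tr F L.
  rewrite [RHS](eq_bigr (fun L : {set 'I_m} =>
     \sum_t (if L == [set t] then embQ (X t * e t) else 0))); last first.
    move=> L _; rewrite rmorph_sum mulr_suml /=; apply: eq_big => [t|t _]; first by rewrite inE.
    case: eqP => [->|_]; last by rewrite rmorph0 mul0r.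
    by rewrite Tr1 rmorphM /= embQX mulrC.
  rewrite exchange_big ce rmorph_sum; apply: eq_big => [t|t _]; first by rewrite inE.
  have t0 : [set t] != set0 by apply/set0Pn; exists t; rewrite inE.
  by rewrite (bigD1 [set t]) //= eqxx big1 ?addr0 // => L /andP[_ /negbTE ->].
exists r; transitivity (\sum_(L : {set 'I_m} | L != set0) embQ (transfer X r L) * Tr F L).
  rewrite Ec [X in _ + X](bigD1 set0) //= Tr0 mulr0 add0r addrC -big_split /=.
  by apply: eq_bigr => L L0; rewrite -(dr L L0) rmorphD mulrDl.
under eq_bigr do rewrite rmorph_sum mulr_suml /=.
rewrite (exchange_big_dep predT) //=; apply: eq_bigr => A _.
rewrite mulr_sumr /=; apply: eq_big => [L|L _]; first by rewrite proper0.
by rewrite rmorphM /= embQ_xmon -mulrA mulrCA.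
Qed.

(** For A = {s, t} the sum is x_t x_s + x_s x_t, zero in characteristic 2; for smaller A it is
    empty. This is why the type I generators start at cardinality 3. *)
Lemma rho_small A : (#|A| <= 2)%N -> rho F A = 0.
Proof.
case: (ltngtP #|A| 2%N) => [cA _|_ //|cA _]; last first.
  have [s [t [st defA]]] := cards2P _ (introT eqP cA).
  have dA s' : (A :\: [set s']) = A :\ s' by [].
  have propA s' : s' \in A -> (set0 \proper [set s']) && ([set s'] \proper A).
    by move=> s'A; rewrite proper0 properEcard sub1set s'A cards1 cA -card_gt0 cards1.
  have As : A :\ s = [set t] by rewrite defA setU1K // inE.
  have At : A :\ t = [set s] by rewrite defA setUC setU1K // inE eq_sym.
  rewrite /rho (bigD1 [set s]) ?propA ?defA ?inE ?eqxx //= -defA As.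
  rewrite (bigD1 [set t]) /= ?propA ?defA ?inE ?eqxx ?orbT //=; last first.
    by apply: contra st => /eqP/setP/(_ t); rewrite !inE eqxx eq_sym.
  rewrite -defA At !Tr1 big1 => [|L].
    by rewrite /xpow !big_set1 addr0 [X in _ + X]mulrC mpoly_addxx.
  case/andP => /andP[/andP[L0 LA] Ls] Lt.
  have /cards1P[u Lu] : #|L| == 1%N.
    by rewrite eqn_leq card_gt0 -proper0 L0 andbT -ltnS -cA proper_card.
  have : u \in A by rewrite -sub1set -Lu proper_sub.
  by move: Ls Lt; rewrite Lu defA !inE !(inj_eq set1_inj) => /negbTE -> /negbTE ->.
apply: big1 => L; rewrite proper0 => /andP[/set0Pn[s sL] /proper_card cL].
move: cA; rewrite ltnS => /(leq_trans cL); rewrite ltnS leqn0 cards_eq0 => /eqP L0.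
by rewrite L0 inE in sL.
Qed.

End Presentation.

(** * Order of a polynomial at the origin, and lowest coefficients of products *)

Section Order.
Variables (R : comNzRingType) (n : nat).
Implicit Types (p q : {mpoly R[n]}) (i j : 'I_n) (k : 'X_{1..n}).

(** Membership in the d-th power of the ideal of all variables. Each [Tr A] counts as degree 1,
    unlike in the grading of Q, so that all the relations start in the same degree 2. *)
Definition ord_ge d p := forall k, (mdeg k < d)%N -> p@_k = 0.

Lemma ord_geM d e p q : ord_ge d p -> ord_ge e q -> ord_ge (d + e) (p * q).
Proof.
move=> pd qe k kde; rewrite mcoeffM big1 // => -[k1 k2] /= /eqP kk.
have [/pd ->|dk1] := ltnP (mdeg k1) d; first by rewrite mul0r.
rewrite [X in _ * X]qe ?mulr0 //; have := congr1 (@mdeg n) kk; rewrite mdegD; lia.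
Qed.

Lemma ord_geD d p q : ord_ge d p -> ord_ge d q -> ord_ge d (p + q).
Proof. by move=> pd qd k kd; rewrite mcoeffD pd ?qd ?addr0. Qed.

Lemma ord_ge_sum d (I : finType) (P : pred I) (G : I -> {mpoly R[n]}) :
  (forall a, P a -> ord_ge d (G a)) -> ord_ge d (\sum_(a | P a) G a).
Proof.
by move=> Gd; apply: (big_ind (ord_ge d)) Gd; [move=> k _; rewrite mcoeff0|exact: ord_geD].
Qed.

Lemma ord_geX i : ord_ge 1 ('X_i : {mpoly R[n]}).
Proof.
move=> k; rewrite ltnS leqn0 mdeg_eq0 => /eqP ->.
by rewrite mcoeffX; case: eqP => // /(congr1 (@mdeg n)); rewrite mdeg0 mdeg1.
Qed.

(** The difference of p and its constant term has order at least 1, so its product with q has order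
    at least d + 1. *)
Lemma mcoeffM_lowest d p q k : ord_ge d q -> mdeg k = d -> (p * q)@_k = p@_0 * q@_k.
Proof.
move=> qd kd; rewrite -{1}[p](subrK (p@_0)%:MP) mulrDl mcoeffD mcoeffCM.
rewrite (@ord_geM 1 d) ?add0r ?kd // => l; rewrite ltnS leqn0 mdeg_eq0 => /eqP ->.
by rewrite mcoeffB mcoeffC eqxx mulr1 subrr.
Qed.

Lemma mcoeff_XM_eq0 i p k : k i = 0%N -> ('X_i * p)@_k = 0.
Proof.
move=> ki; rewrite mcoeffM big1 // => -[k1 k2] /= /eqP kk.
rewrite mcoeffX; case: eqP => [k1i|]; last by rewrite mul0r.
by have := congr1 (fun l : 'X_{1..n} => l i) kk; rewrite ki -k1i mnmDE mnm1E eqxx.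
Qed.

Lemma mnm1_inj (i j : 'I_n) : U_(i)%MM = U_(j)%MM -> i = j.
Proof.
by move/(congr1 (fun k : 'X_{1..n} => k i)); rewrite !mnm1E eqxx; case: eqP.
Qed.

Lemma mnm1D_eq (i j i' j' : 'I_n) : (U_(i) + U_(j))%MM = (U_(i') + U_(j'))%MM ->
  (i = i' /\ j = j') \/ (i = j' /\ j = i').
Proof.
move=> ij; have := congr1 (fun k : 'X_{1..n} => k i) ij; rewrite !mnmDE !mnm1E eqxx.
case: (eqVneq i' i) ij => [->|_] ij; first left.
  by split=> //; apply: mnm1_inj; apply/eqP; move/eqP: ij; rewrite eqm_add2l.
case: (eqVneq j' i) ij => [->|_] // ij; right.
by split=> //; apply: mnm1_inj; apply/eqP; move/eqP: ij; rewrite [(U_(i') + _)%MM]addmC eqm_add2l.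
Qed.

End Order.

(** * Degree 2 coefficients of the relations *)

Section Minimality.
Variables (F : fieldType) (m : nat).
Implicit Types (A B L : {set 'I_m}) (s t : 'I_m).

Local Notation Q := (Qring F m).

Lemma ord_ge_Tr L : ord_ge _ _ 1 (Tr F L).
Proof.
case: (Tr_cases _ L) => [->|[s ->]|[cL _]].
- by rewrite Tr0 => k _; rewrite mcoeff0.
- by rewrite Tr1; apply: ord_geX.
- by rewrite Tr_ge2; apply: ord_geX.
Qed.

Lemma xpowD1 s A : s \in A -> xpow F A = Qx F s * xpow F (A :\ s).
Proof. by move=> sA; rewrite /xpow (big_setD1 s). Qed.

Lemma ord_ge_xpow A : A != set0 -> ord_ge _ _ 1 (xpow F A).
Proof.
by case/set0Pn => s /xpowD1 ->; apply: (ord_geM _ _ 1 0) => //; apply: ord_geX.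
Qed.

Lemma setD_proper_neq0 L A : L \proper A -> A :\: L != set0.
Proof. by rewrite properE setD_eq0 => /andP[]. Qed.

Lemma ord_ge_rho A : ord_ge _ _ 2 (rho F A).
Proof.
apply: ord_ge_sum => L /andP[_ /setD_proper_neq0 AL].
exact: (ord_geM _ _ 1 1 _ _ (ord_ge_xpow _ AL) (ord_ge_Tr _)).
Qed.

Lemma ord_ge_typeII A B : ord_ge _ _ 2 (typeII F A B).
Proof.
apply: ord_geD; first apply: ord_geD.
- exact: (ord_geM _ _ 1 1 _ _ (ord_ge_Tr _) (ord_ge_Tr _)).
- apply: ord_ge_sum => L /setD_proper_neq0 IL; apply: (ord_geM _ _ 1 1); last exact: ord_ge_Tr.
  by apply: (ord_geM _ _ 1 0) => //; apply: ord_ge_xpow.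
- apply: (ord_geM _ _ 0 2) => //; apply: ord_ge_sum => L /setD_proper_neq0 JL.
  exact: (ord_geM _ _ 1 1 _ _ (ord_ge_xpow _ JL) (ord_ge_Tr _)).
Qed.

Definition mTrTr (C D : TrIdx m) : 'X_{1.. #|{: QVar m}|} :=
  (U_(enum_rank (inr C : QVar m)) + U_(enum_rank (inr D : QVar m)))%MM.

Lemma mTrTr_x C D s : mTrTr C D (enum_rank (inl (inl s) : QVar m)) = 0%N.
Proof. by rewrite /mTrTr mnmDE !mnm1E !(inj_eq enum_rank_inj). Qed.

Lemma xpow_mTrTr C D A (p : Q) : A != set0 -> (xpow F A * p)@_(mTrTr C D) = 0.
Proof.
case/set0Pn => s /xpowD1 ->; rewrite -mulrA; apply: mcoeff_XM_eq0.
exact: mTrTr_x.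
Qed.

Lemma rho_mTrTr C D A : (rho F A)@_(mTrTr C D) = 0.
Proof.
rewrite raddf_sum big1 // => L /andP[_ /setD_proper_neq0 AL].
exact: xpow_mTrTr.
Qed.

(** Apart from [Tr A * Tr B], every term carries a factor x_s, because I - L or J - L is nonempty
    for a proper subset L. *)
Lemma typeII_mTrTr (C D A B : TrIdx m) :
  (typeII F (val A) (val B))@_(mTrTr C D) = (mTrTr A B == mTrTr C D)%:R.
Proof.
rewrite /typeII !mcoeffD mulr_sumr !raddf_sum /= big1 ?addr0 => [|L /setD_proper_neq0 IL].
  rewrite big1 ?addr0 => [|L /setD_proper_neq0 JL]; last by rewrite mulrCA xpow_mTrTr.
  by case: A B => [A cA] [B cB]; rewrite !Tr_ge2 /Qvar -mpolyXD mcoeffX.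
by rewrite -mulrA xpow_mTrTr.
Qed.

Definition mxTr s (C : TrIdx m) : 'X_{1.. #|{: QVar m}|} :=
  (U_(enum_rank (inl (inl s) : QVar m)) + U_(enum_rank (inr C : QVar m)))%MM.

(** A term of [rho B] contributes to x_s Tr(C) only if B - L = {s}; then B - s = C = A - s with s in
    both sets, so B = A. The bound 3 makes [Tr (B :\ s)] a variable of its own rather than some
    x_t. *)
Lemma rho_mxTr s A (C : TrIdx m) B :
  s \in A -> val C = A :\ s -> (3 <= #|B|)%N -> (rho F B)@_(mxTr s C) = (B == A)%:R.
Proof.
move=> sA CA cB; rewrite raddf_sum /=.
have term L t : t \in B :\: L -> t != s -> (xpow F (B :\: L) * Tr F L)@_(mxTr s C) = 0.
  move=> /xpowD1 -> ts; rewrite -mulrA; apply: mcoeff_XM_eq0.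
  rewrite mnmDE !mnm1E !(inj_eq enum_rank_inj) addn0.
  by case: eqP => // -[st]; rewrite st eqxx in ts.
have termE L : L \proper B -> L != B :\ s -> (xpow F (B :\: L) * Tr F L)@_(mxTr s C) = 0.
  move=> LB LBs; have [t /andP[]|BLs] := pickP [pred t | (t \in B :\: L) && (t != s)].
    exact: term.
  case/negP: LBs; apply/eqP/setP => t; rewrite !inE; have /= := BLs t; rewrite inE.
  have [u uBL] := set0Pn _ (setD_proper_neq0 _ _ LB).
  have us : u = s by apply/eqP; move: (BLs u); rewrite /= uBL /=; case: eqP.
  move: uBL; rewrite us inE => /andP[sL sB].
  case: (eqVneq t s) => [->|_]; first by rewrite (negbTE sL).
  have := subsetP (proper_sub LB) t.
  by case: (t \in L) => [/(_ isT) ->|] //; case: (t \in B).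
have [sB|sB] := boolP (s \in B); last first.
  rewrite big1 => [|L /andP[_ LB]]; last first.
    apply: termE => //; apply: contraTneq LB => ->.
    suff -> : B :\ s = B by rewrite properxx.
    by apply/setP => t; rewrite !inE; case: eqP => // ->; rewrite (negbTE sB).
  by case: eqP => // BA; rewrite BA sA in sB.
have cBs : (2 <= #|B :\ s|)%N by move: cB; rewrite (cardsD1 s) sB.
rewrite (bigD1 (B :\ s)) /=; last first.
  by rewrite proper0 -card_gt0 (ltnW cBs) properD1.
rewrite big1 ?addr0 => [|L /andP[/andP[_ LB]]]; last exact: termE.
have -> : B :\: (B :\ s) = [set s].
  by apply/setP => t; rewrite !inE; case: eqP => [->|] //=; case: (t \in B).
rewrite /xpow big_set1 Tr_ge2 /Qx /Qvar -mpolyXD mcoeffX eqm_add2l; congr (_%:R).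
congr nat_of_bool; apply/eqP/eqP => [/mnm1_inj/enum_rank_inj[]|BA].
  by move/(congr1 val); rewrite /= CA => BA; rewrite -(setD1K sB) BA setD1K.
by congr (U_(enum_rank (inr _)))%MM; apply: val_inj; rewrite /= CA BA.
Qed.

End Minimality.

(** * The numbers of type I and type II relations *)

Section Counting.
Variable m : nat.

Let card_subsets_eq k : #|[set A : {set 'I_m} | #|A| == k]| = 'C(m, k).
Proof. by rewrite card_draws card_ord. Qed.

Lemma card_subsets_ge2 : #|{: TrIdx m}| = (2 ^ m - m - 1)%N.
Proof.
rewrite card_sig -cardsE; have := cardsC [set A : {set 'I_m} | (2 <= #|A|)%N].
have -> : #|~: [set A : {set 'I_m} | (2 <= #|A|)%N]| = (m + 1)%N.
  transitivity ('C(m, 1) + 'C(m, 0))%N; last by rewrite bin1 bin0.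
  rewrite -!card_subsets_eq -cardUI [X in (_ + X)%N]eq_card0 ?addn0 => [|A]; last first.
    by rewrite !inE; case: #|A| => [|[]].
  by apply: eq_card => A; rewrite !inE; case: #|A| => [|[|]].
rewrite -cardsT -powersetT card_powerset cardsT card_ord.
by move=> <-; rewrite -subnDA addnK.
Qed.

Lemma card_subsets_ge3 : #|{: TypeIdx m}| = (2 ^ m - 'C(m, 2) - m - 1)%N.
Proof.
have := card_subsets_ge2; rewrite [X in X = _ -> _]card_sig -[X in X = _ -> _]cardsE.
rewrite [X in _ -> X = _]card_sig -[X in _ -> X = _]cardsE.
rewrite -(cardsID [set A : {set 'I_m} | (3 <= #|A|)%N]).
have -> : [set A : {set 'I_m} | (2 <= #|A|)%N] :\: [set A : {set 'I_m} | (3 <= #|A|)%N]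
    = [set A : {set 'I_m} | #|A| == 2%N].
  by apply/setP => A; rewrite !inE; case: #|A| => [|[|[|]]].
have -> : [set A : {set 'I_m} | (2 <= #|A|)%N] :&: [set A : {set 'I_m} | (3 <= #|A|)%N]
    = [set A : {set 'I_m} | (3 <= #|A|)%N].
  by apply/setP => A; rewrite !inE; case: #|A| => [|[|[|]]].
rewrite card_subsets_eq => /(canRL (addnK _)) ->.
by rewrite -!subnDA; congr subn; lia.
Qed.

(** With n = 2^m - m - 1 variables [Tr], summing P(a, b) + P(b, a) = 1 + [a = b] over all ordered
    pairs counts the chosen pairs twice and gives n^2 + n, that is, twice the binomial of n + 1 over
    2. *)
Lemma card_unordered_pairs (P : pred (TrIdx m * TrIdx m)) :
  ordering_choice P -> #|{: TypeIIdx P}| = 'C(2 ^ m - m, 2).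
Proof.
move=> oP; have cE : 'C(2 ^ m - m, 2) = 'C(#|{: TrIdx m}|.+1, 2).
  congr 'C(_, 2); rewrite card_subsets_ge2; have := ltn_expl m (isT : 1 < 2)%N; lia.
have PE a b : (P (a, b) + P (b, a) = 1 + (a == b))%N.
  have [] := oP a b; case: eqP => [->|ab]; first by rewrite orbb => ->.
  by case: (P (a, b)); case: (P (b, a)) => //= _ /(_ isT).
rewrite cE bin2 /= card_sig; set N := #|_|.
have NE : N = (\sum_(p : TrIdx m * TrIdx m) P p)%N.
  by rewrite /N -sum1_card big_mkcond; apply: eq_bigr => p _; rewrite unfold_in; case: (P p).
have sumE : (\sum_(p : TrIdx m * TrIdx m) P p)%N = (\sum_a \sum_b P (a, b))%N.
  by rewrite pair_bigA; apply: eq_bigr => -[].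
suff : (N + N = #|{: TrIdx m}|.+1 * #|{: TrIdx m}|)%N by move=> <-; rewrite addnn doubleK.
rewrite {2}NE NE sumE {2}exchange_big -big_split /=.
rewrite (eq_bigr (fun a : TrIdx m => #|{: TrIdx m}|.+1)); first by rewrite sum_nat_const mulnC.
move=> a _; rewrite -big_split /= (eq_bigr _ (fun b _ => PE a b)) big_split /= sum1_card.
rewrite -[RHS]addn1; congr (_ + _)%N.
by rewrite (bigD1 a) //= eqxx big1 // => b /negbTE; rewrite eq_sym => ->.
Qed.

End Counting.

(** * Generation and minimality for a choice of orderings *)

Section MainTheorem.
Variables (F : fieldType) (m : nat) (P : pred (TrIdx m * TrIdx m)).
Hypotheses (pchar2 : (2 \in [pchar F])%N) (oP : ordering_choice P).

Local Notation g := (gens F m P).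

Lemma pi_in_ideal q : in_ideal_gen g q -> pi_morph F m q = 0.
Proof.
move=> [c ->]; rewrite rmorph_sum big1 // => -[A|p] _; rewrite rmorphM /=.
  by rewrite pi_rho ?mulr0 // -card_gt0; apply: leq_trans (valP A).
by rewrite pi_typeII ?mulr0.
Qed.

Lemma gens_generate : generates g (@in_ker_pi F m).
Proof.
move=> q; rewrite /in_ker_pi pi_morphE; split=> [|qK]; first exact: pi_in_ideal.
have [A B cA cB|a [c [d aE]] qa] := all_reducible F m _ g _ q.
  have [/orP[PAB|PBA] _] := oP (exist _ A cA) (exist _ B cB).
    by left; apply: (in_ideal_mem _ _ g (inr (exist (fun p => P p) (exist _ A cA, exist _ B cB) PAB))).
  by right; apply: (in_ideal_mem _ _ g (inr (exist (fun p => P p) (exist _ B cB, exist _ A cA) PBA))).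
have a0 : pi_morph F m a = 0.
  by have := pi_in_ideal _ qa; rewrite rmorphB /= qK sub0r => /eqP; rewrite oppr_eq0 => /eqP.
rewrite -(subrK a q); apply: in_idealD => //.
move: a0; rewrite aE => /kernel_Rlin[] // r ->; apply: in_ideal_sum => A _.
apply: in_idealM; case: (leqP #|A| 2) => cA.
  by rewrite rho_small //; apply: in_ideal0.
exact: (in_ideal_mem _ _ g (inl (exist _ A cA))).
Qed.

Lemma ord_ge_gens i : ord_ge _ _ 2 (g i).
Proof. by case: i => [A|p]; [apply: ord_ge_rho | apply: ord_ge_typeII]. Qed.

Lemma gens_mTrTr i (p : TypeIIdx P) :
  (g i)@_(mTrTr m (val p).1 (val p).2) = (i == inr p)%:R.
Proof.
case: i => [A|p'] /=; first by rewrite rho_mTrTr.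
rewrite typeII_mTrTr; congr (_%:R); congr nat_of_bool; apply/eqP/eqP => [|[->] //].
move=> /mnm1D_eq E; congr inr; apply: val_inj.
case: p p' E => [[C D] PCD] [[A B] PAB] /= [].
  by case=> /enum_rank_inj[->] /enum_rank_inj[->].
(* The two indices are opposite orderings of one pair; as both lie in [P], [ordering_choice] makes
   the two entries equal. *)
case=> /enum_rank_inj[AD] /enum_rank_inj[BC].
by have [_ CD] := oP C D; rewrite AD BC CD // PCD -AD -BC PAB.
Qed.

(* All generators have order at least 2, so in a relation between them the degree 2
   coefficients only see the constant terms of the cofactors. The coefficients of the
   Tr(C) Tr(D) isolate the type II generators; those of x_s Tr(A - s) then isolate rho A. *)
Lemma gens_drop_not_generate i : ~ generates (@drop_gen _ _ g i) (@in_ker_pi F m).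
Proof.
move=> gen; have : in_ker_pi (g i) by apply/gens_generate; apply: in_ideal_mem.
case/gen => c giE.
have coefE k : mdeg k = 2%N -> (g i)@_k = \sum_(j : {j | j != i}) (c j)@_0 * (g (val j))@_k.
  move=> k2; rewrite giE raddf_sum; apply: eq_bigr => j _.
  by apply: (mcoeffM_lowest _ _ 2) k2; apply: ord_ge_gens.
have deg2 (a b : 'I_#|{: QVar m}|) : mdeg (U_(a) + U_(b))%MM = 2%N by rewrite mdegD !mdeg1.
case: i c giE gen coefE => [A|p] c giE gen coefE; last first.
  have := coefE (mTrTr m (val p).1 (val p).2) (deg2 _ _); rewrite gens_mTrTr eqxx.
  rewrite big1 => [/eqP|j _]; first by rewrite oner_eq0.
  by rewrite gens_mTrTr (negbTE (valP j)) mulr0.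
(* The left side [rho A] has no monomial Tr(C) Tr(D). The type II cofactors must be disposed of
   first, since type II relations can themselves contain monomials x_s Tr(C). *)
have cII j p : val j = inr p -> (c j)@_0 = 0.
  move=> jp; have := coefE (mTrTr m (val p).1 (val p).2) (deg2 _ _); rewrite gens_mTrTr (bigD1 j) //=.
  rewrite big1 => [|j' j'j]; rewrite gens_mTrTr.
    by rewrite addr0 jp eqxx mulr1 => <-.
  rewrite -jp (inj_eq val_inj) (negbTE j'j) mulr0 //.
have [s sA] : exists s, s \in val A.
  by apply/set0Pn; rewrite -card_gt0; apply: leq_trans (valP A).
have cAs : (2 <= #|val A :\ s|)%N by have := valP A; rewrite /= (cardsD1 s) sA.
pose C : TrIdx m := exist _ (val A :\ s) cAs.
have := coefE (mxTr m s C) (deg2 _ _).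
rewrite [X in X = _ -> _](rho_mxTr F m s (val A) C) ?(valP A) // eqxx.
rewrite big1 => [/eqP|j _]; first by rewrite oner_eq0.
case jE : (val j) => [B|p]; last by rewrite (cII _ _ jE) mul0r.
rewrite /= (rho_mxTr F m s (val A) C) ?(valP B) //.
by have := valP j; rewrite jE (inj_eq (@inl_inj _ _)) (inj_eq val_inj) => /negbTE ->; rewrite mulr0.
Qed.

End MainTheorem.

Theorem mainTheorem4 (F : fieldType) (m : nat) (P : pred (TrIdx m * TrIdx m)) :
  (2 \in [pchar F])%N -> (1 <= m)%N -> ordering_choice P ->
  [/\ #|{: TypeIdx m}| = (2 ^ m - 'C(m, 2) - m - 1)%N,
      #|{: TypeIIdx P}| = 'C(2 ^ m - m, 2)
    & minimally_generates (gens F m P) (@in_ker_pi F m)].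
Proof.
move=> pchar2 _ oP; split; [exact: card_subsets_ge3 | exact: card_unordered_pairs | split].
  exact: gens_generate.
by move=> i; apply: gens_drop_not_generate.
Qed.
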